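(* Let $\Omega=\Omega_\infty:=\mathbb R\times(-1,1)$ or $\Omega=\mathbb R^2_+:=\mathbb R\times(0,\infty)$. There exists a bounded Type III flow $\mathbf v\in C^\infty(\bar\Omega)$, i.e. there exists a bounded solution $\mathbf v=(v_1,v_2)\in C^\infty(\bar\Omega)$ of $$\mathbf v\cdot\nabla\mathbf v+\nabla P=0,\quad \operatorname{div}\mathbf v=0\quad\text{in }\Omega,\qquad v_2=0\quad\text{on }\partial\Omega,$$ which satisfies either $\Theta(\mathbf v;\bar\Omega)=S^1_+$ or $\Theta(\mathbf v;\bar\Omega)=S^1_-$.
   Context: $P$ denotes the pressure (some function on $\Omega$ for which the equations hold). For a vector field $\mathbf u$ on a set $D$, the set of flow angles is $$\Theta(\mathbf u;D)=\left\{\tfrac{\mathbf u(x)}{|\mathbf u(x)|}: x\in D,\ |\mathbf u(x)|>0\right\}\subset S^1 .$$ $S^1_+=\{(\cos\theta,\sin\theta):0\le\theta\le\pi\}$ and $S^1_-=\{(\cos\theta,\sin\theta):-\pi\le\theta\le0\}$ are the upper and lower closed semicircles. *)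

(* Defs.v *)
From Stdlib Require Import Reals List.
From Coquelicot Require Import Coquelicot.
Open Scope R_scope.

Definition strip (p : R * R) : Prop := -1 < snd p < 1.

Definition upper_half_plane (p : R * R) : Prop := 0 < snd p.

Definition closure (D : R * R -> Prop) (p : R * R) : Prop :=
  forall U : R * R -> Prop, locally p U -> exists q, D q /\ U q.

Definition boundary (D : R * R -> Prop) (p : R * R) : Prop :=
  closure D p /\ ~ locally p D.

Inductive axis : Set := axis1 | axis2.

Definition slice (a : axis) (f : R * R -> R) (p : R * R) (t : R) : R :=
  match a with
  | axis1 => f (t, snd p)
  | axis2 => f (fst p, t)
  end.

Definition coord (a : axis) (p : R * R) : R :=
  match a with
  | axis1 => fst p
  | axis2 => snd p
  end.

Definition ex_partial (a : axis) (f : R * R -> R) (p : R * R) : Prop :=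
  ex_derive (slice a f p) (coord a p).

Definition partial (a : axis) (f : R * R -> R) (p : R * R) : R :=
  Derive (slice a f p) (coord a p).

Definition iter_partial (w : list axis) (f : R * R -> R) : R * R -> R :=
  fold_right partial f w.

(* f is in C^oo(closure Omega), for Omega open: all partial derivatives of all
   orders exist in Omega and extend continuously to the closure, the extension
   of f itself being f.  The values of f off the closure play no role, because
   derivatives are only taken at points of the open set Omega. *)
Definition smooth_on_closure (Omega : R * R -> Prop) (f : R * R -> R) : Prop :=
  continuous_on (closure Omega) f /\
  forall w : list axis,
    (forall (a : axis) (p : R * R),
        Omega p -> ex_partial a (iter_partial w f) p) /\
    exists g : R * R -> R,
      continuous_on (closure Omega) g /\
      forall p, Omega p -> g p = iter_partial w f p.

(* [ex_filterdiff P (locally p)] is Frechet differentiability of P at p; as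
   the gradient of P is then smooth, it forces P to be smooth in Omega. *)
Definition steady_euler_slip
    (Omega : R * R -> Prop) (v1 v2 P : R * R -> R) : Prop :=
  (forall p, Omega p ->
     ex_filterdiff P (locally p) /\
     v1 p * partial axis1 v1 p + v2 p * partial axis2 v1 p
       + partial axis1 P p = 0 /\
     v1 p * partial axis1 v2 p + v2 p * partial axis2 v2 p
       + partial axis2 P p = 0 /\
     partial axis1 v1 p + partial axis2 v2 p = 0) /\
  (forall p, boundary Omega p -> v2 p = 0).

(* Coquelicot's [norm] on [R * R] is the Euclidean one. *)
Definition bounded_on (D : R * R -> Prop) (u : R * R -> R * R) : Prop :=
  exists M : R, forall p, D p -> norm (u p) <= M.

Definition flow_angles (u : R * R -> R * R) (D : R * R -> Prop)
    (e : R * R) : Prop :=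
  exists p, D p /\ 0 < norm (u p) /\ e = scal (/ norm (u p)) (u p).

Definition upper_semicircle (e : R * R) : Prop :=
  exists theta, 0 <= theta <= PI /\ e = (cos theta, sin theta).

Definition lower_semicircle (e : R * R) : Prop :=
  exists theta, - PI <= theta <= 0 /\ e = (cos theta, sin theta).

Definition same_set (A B : R * R -> Prop) : Prop := forall e, A e <-> B e.

(* Main.v *)
Require Import Defs.
From Stdlib Require Import Reals List.
From Coquelicot Require Import Coquelicot.
From Stdlib Require Import Lra FunctionalExtensionality.
Open Scope R_scope.

(** The flow is [v = (- d_y psi, d_x psi)] for the stream function
    [psi = arctan (T G)] with [T = tanh (k x)] and [G = G y].  If the profile
    [G] satisfies, for constants [k > 0] and [q],
      [G'^2 = k^2 (1 + G^4) + q G^2],  [G'' = 2 k^2 G^3 + q G],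
    then the Laplacian of [psi] is
    [(q - 2 k^2) T G (1 - (T G)^2) / (1 + (T G)^2)^2], which is
    [(q - 2 k^2) / 4 * sin (4 psi)]: this is the separation of variables for
    the elliptic sine-Gordon equation.  A vorticity that is a function [f] of
    the stream function solves the steady Euler equations, with pressure
    [- |v|^2 / 2] plus a primitive of [f] at [psi].

    With [D = 1 / (1 + T^2 G^2)] the velocity is [v1 = - T G' D] and
    [v2 = k (1 - T^2) G D].  Hence [v2] has the sign of [G], and everything
    reduces to finding a bounded profile that is positive in the domain and
    vanishes, with nonzero slope, on its boundary ([profile_flow]).  The flow
    then comes in along the lower boundary from both sides, towards a
    stagnation point at [x = 0], and turns upwards.  All angles occur: on a
    boundary line [v1] changes sign with [x], and on a horizontal line where
    [G] and [G'] do not vanish, [v1 / v2] is a nonzero multiple of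
    [T / (1 - T^2) = sinh (2 k x) / 2], which takes every real value.

    In the half-plane [G = tanh], [k = 1], [q = -2] works
    ([half_plane_profile]); [psi] is then a saddle solution.  In the strip,
    [G] is a Jacobi elliptic sine, obtained as [sin theta / 2] where [theta]
    solves the scalar autonomous equation
    [theta' = lam sqrt (1 - (sin theta)^2 / 16)] and runs from [0] to [PI]
    across the strip ([autonomous_flow], [strip_profile]).

    For smoothness, [T], [G], [G'] and [D] generate an algebra of continuous
    functions on the whole plane closed under both partial derivatives, which
    contains the velocity and the pressure ([eval_smooth]). *)

(** * Derivatives and hyperbolic functions *)

Lemma is_derive_continuous :
  forall (f : R -> R) x l, is_derive f x l -> continuous f x.
Proof.
  intros f x l D.
  apply (ex_derive_continuous (K := R_AbsRing) (V := R_NormedModule)).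
  now exists l.
Qed.

Lemma cosh_pos : forall x, 0 < cosh x.
Proof.
  intros x; unfold cosh.
  pose proof (exp_pos x); pose proof (exp_pos (- x)); lra.
Qed.

Lemma cosh2_sinh2 : forall x, cosh x ^ 2 - sinh x ^ 2 = 1.
Proof.
  intros x.
  assert (E : exp x * exp (- x) = 1)
    by (rewrite <- exp_plus, Rplus_opp_r; apply exp_0).
  unfold cosh, sinh.
  replace (((exp x + exp (- x)) / 2) ^ 2 - ((exp x - exp (- x)) / 2) ^ 2)
    with (exp x * exp (- x)) by field.
  exact E.
Qed.

Lemma one_minus_tanh2 : forall x, 1 - tanh x ^ 2 = / cosh x ^ 2.
Proof.
  intros x; pose proof (cosh_pos x); pose proof (cosh2_sinh2 x) as E.
  unfold tanh.
  replace (1 - (sinh x / cosh x) ^ 2)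
    with ((cosh x ^ 2 - sinh x ^ 2) / cosh x ^ 2) by (field; lra).
  rewrite E; field; lra.
Qed.

Lemma one_minus_tanh2_pos : forall x, 0 < 1 - tanh x ^ 2.
Proof.
  intros x; rewrite one_minus_tanh2.
  apply Rinv_0_lt_compat, pow_lt, cosh_pos.
Qed.

Lemma is_derive_tanh : forall x, is_derive tanh x (1 - tanh x ^ 2).
Proof.
  intros x; pose proof (cosh_pos x).
  replace (1 - tanh x ^ 2)
    with ((cosh x * cosh x - sinh x * sinh x) / cosh x ^ 2)
    by (unfold tanh; field; lra).
  apply (is_derive_div sinh cosh).
  - apply is_derive_Reals, derivable_pt_lim_sinh.
  - apply is_derive_Reals, derivable_pt_lim_cosh.
  - lra.
Qed.

Lemma mul_tanh_pos : forall t, t <> 0 -> 0 < t * tanh t.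
Proof.
  intros t Ht; pose proof (cosh_pos t) as C.
  assert (S : 0 < t * sinh t).
  { destruct (Rtotal_order t 0) as [L | [E | G]]; [| contradiction |].
    - pose proof (sinh_lt t 0 L) as S; rewrite sinh_0 in S; nra.
    - pose proof (sinh_lt 0 t G) as S; rewrite sinh_0 in S; nra. }
  unfold tanh.
  replace (t * (sinh t / cosh t)) with (t * sinh t / cosh t) by (field; lra).
  now apply Rdiv_lt_0_compat.
Qed.

(** The ratio [tanh t / (1 - tanh t ^ 2)] is [sinh (2 t) / 2]. *)
Lemma tanh_ratio_surjective :
  forall a, exists t, tanh t = a * (1 - tanh t ^ 2).
Proof.
  intros a; exists (arcsinh (2 * a) / 2).
  set (t := arcsinh (2 * a) / 2).
  assert (S : sinh (t + t) = 2 * a).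
  { replace (t + t) with (arcsinh (2 * a)) by (unfold t; field).
    apply sinh_arcsinh. }
  assert (D : sinh (t + t) = 2 * (sinh t * cosh t)).
  { unfold sinh, cosh; rewrite Ropp_plus_distr, !exp_plus; field. }
  pose proof (cosh_pos t).
  rewrite one_minus_tanh2; unfold tanh.
  replace a with (sinh t * cosh t) by lra.
  field; lra.
Qed.

(** * Profiles and the algebra generated by the flow *)

(** The ordinary differential equation that a factor [G y] has to satisfy for
    [arctan (tanh (k x) * G y)] to solve an elliptic sine-Gordon equation.
    [energy] is a first integral of [slope_derive], so it amounts to a choice
    of initial data. *)
Record profile := {
  rate : R;
  lin : R;
  prof : R -> R;
  slope : R -> R;
  rate_pos : 0 < rate;
  prof_derive : forall y, is_derive prof y (slope y);
  slope_derive : forall y,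
    is_derive slope y (2 * rate ^ 2 * prof y ^ 3 + lin * prof y);
  energy : forall y,
    slope y ^ 2 = rate ^ 2 * (1 + prof y ^ 4) + lin * prof y ^ 2;
  prof_bounded : exists M, forall y, Rabs (prof y) <= M;
  slope_bounded : exists M, forall y, Rabs (slope y) <= M
}.

(** Polynomial expressions in four generators: [Th] is [tanh (k x)], [Pr] and
    [Sl] are [G y] and [G' y], and [Dn] is [1 / (1 + (tanh (k x) * G y) ^ 2)].
    Working with expressions makes the closure under differentiation a
    structural recursion, [diff]. *)
Inductive term :=
  | Const (c : R) | Th | Pr | Sl | Dn
  | Add (s t : term) | Mul (s t : term).

Definition layer (w : profile) (x : R) : R := tanh (rate w * x).

(** The derivative of [arctan] at [T G]. *)
Definition arctan_slope (w : profile) (p : R * R) : R :=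
  / (1 + (layer w (fst p) * prof w (snd p)) ^ 2).

Fixpoint eval (w : profile) (t : term) (p : R * R) : R :=
  match t with
  | Const c => c
  | Th => layer w (fst p)
  | Pr => prof w (snd p)
  | Sl => slope w (snd p)
  | Dn => arctan_slope w p
  | Add s t => eval w s p + eval w t p
  | Mul s t => eval w s p * eval w t p
  end.

Definition Sq (t : term) : term := Mul t t.

Definition layer_slope (w : profile) : term :=
  Mul (Const (rate w)) (Add (Const 1) (Mul (Const (-1)) (Sq Th))).

Fixpoint diff (w : profile) (a : axis) (t : term) : term :=
  match t with
  | Const _ => Const 0
  | Th => match a with axis1 => layer_slope w | axis2 => Const 0 end
  | Pr => match a with axis1 => Const 0 | axis2 => Sl end
  | Sl =>
      match a with
      | axis1 => Const 0
      | axis2 => Add (Mul (Const (2 * rate w ^ 2)) (Mul Pr (Sq Pr)))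
                     (Mul (Const (lin w)) Pr)
      end
  | Dn =>
      Mul (Mul (Const (-2)) (Sq Dn))
        match a with
        | axis1 => Mul (Mul Th (layer_slope w)) (Sq Pr)
        | axis2 => Mul (Sq Th) (Mul Pr Sl)
        end
  | Add s t => Add (diff w a s) (diff w a t)
  | Mul s t => Add (Mul (diff w a s) t) (Mul s (diff w a t))
  end.

Lemma denominator_pos :
  forall w p, 0 < 1 + (layer w (fst p) * prof w (snd p)) ^ 2.
Proof.
  intros w p; pose proof (pow2_ge_0 (layer w (fst p) * prof w (snd p))); lra.
Qed.

Lemma layer_derive :
  forall w x, is_derive (layer w) x (rate w * (1 - layer w x ^ 2)).
Proof.
  intros w x; unfold layer.
  apply (is_derive_comp tanh (fun x => rate w * x)).
  - apply is_derive_tanh.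
  - auto_derive; [trivial | ring].
Qed.

Lemma eval_slice_derive :
  forall w a t p,
    is_derive (slice a (eval w t) p) (coord a p) (eval w (diff w a t) p).
Proof.
  intros w a t p; induction t.
  - apply (is_derive_ext (fun _ => c)); [now destruct a |].
    apply (is_derive_const c).
  - destruct a; cbn.
    + apply (is_derive_ext (layer w)); [easy |].
      replace (rate w * _) with (rate w * (1 - layer w (fst p) ^ 2)) by ring.
      apply layer_derive.
    + apply (is_derive_const (layer w (fst p))).
  - destruct a; cbn.
    + apply (is_derive_const (prof w (snd p))).
    + apply prof_derive.
  - destruct a; cbn.
    + apply (is_derive_const (slope w (snd p))).
    + replace (_ + _) with
        (2 * rate w ^ 2 * prof w (snd p) ^ 3 + lin w * prof w (snd p)) by ring.
      apply slope_derive.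
  - pose proof (denominator_pos w p) as pos.
    destruct a; cbn [slice coord eval diff Sq layer_slope]; unfold arctan_slope.
    + evar_last.
      * apply (is_derive_inv
                 (fun x => 1 + (layer w x * prof w (snd p)) ^ 2)).
        -- apply (is_derive_comp (fun z => 1 + (z * prof w (snd p)) ^ 2));
             [| apply layer_derive].
           auto_derive; [trivial | reflexivity].
        -- lra.
      * cbn; field; lra.
    + evar_last.
      * apply (is_derive_inv
                 (fun y => 1 + (layer w (fst p) * prof w y) ^ 2)).
        -- apply (is_derive_comp (fun z => 1 + (layer w (fst p) * z) ^ 2));
             [| apply prof_derive].
           auto_derive; [trivial | reflexivity].
        -- lra.
      * cbn; field; lra.
  - apply (is_derive_ext
             (fun x => slice a (eval w t1) p x + slice a (eval w t2) p x));
      [now destruct a |].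
    now apply (is_derive_plus (slice a (eval w t1) p)).
  - apply (is_derive_ext
             (fun x => slice a (eval w t1) p x * slice a (eval w t2) p x));
      [now destruct a |].
    evar_last.
    + apply (is_derive_mult (slice a (eval w t1) p));
        [eassumption | eassumption | exact Rmult_comm].
    + destruct a, p; reflexivity.
Qed.

Lemma eval_continuous : forall w t p, continuous (eval w t) p.
Proof.
  intros w t p.
  assert (T : continuous (fun p => layer w (fst p)) p).
  { apply (continuous_comp fst (layer w)); [apply continuous_fst |].
    eapply is_derive_continuous, layer_derive. }
  assert (G : continuous (fun p => prof w (snd p)) p).
  { apply (continuous_comp snd (prof w)); [apply continuous_snd |].
    eapply is_derive_continuous, prof_derive. }
  induction t; cbn.
  - apply continuous_const.
  - exact T.
  - exact G.
  - apply (continuous_comp snd (slope w)); [apply continuous_snd |].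
    eapply is_derive_continuous, slope_derive.
  - apply (continuous_comp
             (fun p => layer w (fst p) * prof w (snd p))
             (fun z => / (1 + z ^ 2))).
    + now apply (continuous_mult (fun p => layer w (fst p))).
    + eapply is_derive_continuous; auto_derive; [| reflexivity].
      pose proof (denominator_pos w p) as pos; cbn in *; lra.
  - now apply (continuous_plus (eval w t1)).
  - now apply (continuous_mult (eval w t1)).
Qed.

Lemma partial_eval :
  forall w a t, partial a (eval w t) = eval w (diff w a t).
Proof.
  intros; apply functional_extensionality; intros p.
  apply is_derive_unique, eval_slice_derive.
Qed.

Lemma iter_partial_eval :
  forall w l t, exists s, iter_partial l (eval w t) = eval w s.
Proof.
  intros w l t; induction l as [| a l [s IH]].
  - now exists t.
  - exists (diff w a s); cbn.
    fold (iter_partial l (eval w t)); rewrite IH; apply partial_eval.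
Qed.

Lemma eval_smooth :
  forall Omega w t, smooth_on_closure Omega (eval w t).
Proof.
  intros Omega w t; split.
  - apply continuous_on_forall; intros p _; apply eval_continuous.
  - intros l; destruct (iter_partial_eval w l t) as [s ->]; split.
    + intros a p _; eexists; apply eval_slice_derive.
    + exists (eval w s); split; [| easy].
      apply continuous_on_forall; intros p _; apply eval_continuous.
Qed.

(** Continuous partial derivatives imply differentiability. *)
Lemma eval_ex_filterdiff :
  forall w t p, ex_filterdiff (eval w t) (locally p).
Proof.
  intros w t [x y]; eexists.
  apply (filterdiff_ext (fun u => eval w t (fst u, snd u)));
    [now intros [] |].
  apply (is_derive_filterdiff (fun a b => eval w t (a, b)) x y
           (fun a b => eval w (diff w axis1 t) (a, b))).
  - apply filter_forall; intros [a b].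
    apply (eval_slice_derive w axis1 t (a, b)).
  - apply (eval_slice_derive w axis2 t (x, y)).
  - apply (continuous_ext (eval w (diff w axis1 t))); [now intros [] |].
    apply eval_continuous.
Qed.

(** * The Euler equations *)

Definition vel1 : term := Mul (Mul (Const (-1)) (Mul Th Sl)) Dn.

Definition vel2 (w : profile) : term := Mul (Mul (layer_slope w) Pr) Dn.

(** Bernoulli's law: [- |v|^2 / 2] plus a primitive of the vorticity as a
    function of [psi], which is [(q - 2 k^2) / 2 * (D - D^2)]. *)
Definition pressure (w : profile) : term :=
  Add (Mul (Const (- / 2)) (Add (Sq vel1) (Sq (vel2 w))))
      (Mul (Const ((lin w - 2 * rate w ^ 2) / 2))
           (Add Dn (Mul (Const (-1)) (Sq Dn)))).

(** Both momentum equations are multiples of the first integral [energy]; the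
    equations for [G''] and [T'] are built into [diff]. *)
Lemma euler_equations :
  forall w p,
    eval w vel1 p * partial axis1 (eval w vel1) p
      + eval w (vel2 w) p * partial axis2 (eval w vel1) p
      + partial axis1 (eval w (pressure w)) p = 0 /\
    eval w vel1 p * partial axis1 (eval w (vel2 w)) p
      + eval w (vel2 w) p * partial axis2 (eval w (vel2 w)) p
      + partial axis2 (eval w (pressure w)) p = 0 /\
    partial axis1 (eval w vel1) p + partial axis2 (eval w (vel2 w)) p = 0.
Proof.
  intros w p; rewrite !partial_eval.
  pose proof (energy w (snd p)) as E; pose proof (denominator_pos w p) as pos.
  cbn [eval diff vel1 vel2 pressure layer_slope Sq]; unfold arctan_slope.
  set (k := rate w) in *; set (q := lin w) in *.
  set (T := layer w (fst p)) in *; set (G := prof w (snd p)) in *.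
  set (H := slope w (snd p)) in *; clearbody k q T G H.
  assert (nz : 1 + (T * G) ^ 2 <> 0) by lra.
  apply Rminus_diag_eq in E.
  split; [| split].
  (* the vorticity exceeds its value as a function of psi by
     - 2 (T G) T^2 D^2 times the defect in the energy identity; in the
     equations this is multiplied by - v2 and by v1 *)
  - transitivity (2 * (k * (1 - T ^ 2) * G) * (T * G) * T ^ 2
        / (1 + (T * G) ^ 2) ^ 3
        * (H ^ 2 - (k ^ 2 * (1 + G ^ 4) + q * G ^ 2))).
    + field; exact nz.
    + rewrite E; ring.
  - transitivity (2 * (T * H) * (T * G) * T ^ 2 / (1 + (T * G) ^ 2) ^ 3
        * (H ^ 2 - (k ^ 2 * (1 + G ^ 4) + q * G ^ 2))).
    + field; exact nz.
    + rewrite E; ring.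
  - field; exact nz.
Qed.

Lemma vel1_eq :
  forall w p,
    eval w vel1 p = - (layer w (fst p) * slope w (snd p)) * arctan_slope w p.
Proof. intros; cbn; ring. Qed.

Lemma vel2_eq :
  forall w p,
    eval w (vel2 w) p
    = rate w * (1 - layer w (fst p) ^ 2) * prof w (snd p) * arctan_slope w p.
Proof. intros; cbn; ring. Qed.

(** * Flow angles *)

Lemma norm_plane : forall a b : R, norm (a, b) = sqrt (a ^ 2 + b ^ 2).
Proof.
  intros a b.
  change (norm (a, b)) with (sqrt (Rabs a ^ 2 + Rabs b ^ 2)).
  now rewrite !pow2_abs.
Qed.

Lemma upper_semicircle_iff :
  forall a b, upper_semicircle (a, b) <-> a ^ 2 + b ^ 2 = 1 /\ 0 <= b.
Proof.
  intros a b; split.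
  - intros (th & [Hl Hu] & E); injection E as -> ->; split.
    + pose proof (sin2_cos2 th) as S; unfold Rsqr in S; lra.
    + now apply sin_ge_0.
  - intros [E B]; exists (acos a); split; [apply acos_bound |].
    rewrite cos_acos, sin_acos by nra.
    f_equal; replace (1 - a²) with (b ^ 2) by (unfold Rsqr; lra).
    symmetry; now apply sqrt_pow2.
Qed.

Lemma flow_angle_upper :
  forall a b : R, 0 < norm (a, b) -> 0 <= b ->
    upper_semicircle (scal (/ norm (a, b)) (a, b)).
Proof.
  intros a b; rewrite norm_plane; intros N B.
  change (upper_semicircle
            (/ sqrt (a ^ 2 + b ^ 2) * a, / sqrt (a ^ 2 + b ^ 2) * b)).
  set (n := sqrt (a ^ 2 + b ^ 2)) in *.
  assert (n2 : n ^ 2 = a ^ 2 + b ^ 2) by (apply pow2_sqrt; nra).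
  apply upper_semicircle_iff; split.
  - replace ((/ n * a) ^ 2 + (/ n * b) ^ 2) with ((a ^ 2 + b ^ 2) / n ^ 2)
      by (field; lra).
    rewrite <- n2; field; lra.
  - apply Rmult_le_pos; [| exact B].
    now apply Rlt_le, Rinv_0_lt_compat.
Qed.

Lemma flow_angle_of_positive_multiple :
  forall (u : R * R -> R * R) (D : R * R -> Prop) p r a b,
    D p -> 0 < r -> a ^ 2 + b ^ 2 = 1 -> u p = (r * a, r * b) ->
    flow_angles u D (a, b).
Proof.
  intros u D p r a b Dp r0 E U; exists p.
  assert (N : norm (u p) = r).
  { rewrite U, norm_plane.
    replace ((r * a) ^ 2 + (r * b) ^ 2) with (r ^ 2 * (a ^ 2 + b ^ 2)) by ring.
    rewrite E, Rmult_1_r; apply sqrt_pow2; lra. }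
  rewrite N; split; [exact Dp | split; [exact r0 |]].
  rewrite U.
  change ((a, b) = (/ r * (r * a), / r * (r * b))).
  f_equal; field; lra.
Qed.

(** * Domains given by a condition on the height *)

Lemma closure_incl :
  forall (Omega : R * R -> Prop) p, Omega p -> closure Omega p.
Proof.
  intros Omega p H U LU; exists p; split; [exact H |].
  now apply locally_singleton.
Qed.

Lemma closure_from_above :
  forall (Omega : R * R -> Prop) x y,
    (forall t, 0 < t < 1 -> Omega (x, y + t)) -> closure Omega (x, y).
Proof.
  intros Omega x y H U [eps B].
  set (t := Rmin (1 / 2) (eps / 2)).
  assert (t0 : 0 < t /\ t <= 1 / 2 /\ t <= eps / 2).
  { pose proof (cond_pos eps); unfold t; split; [| split].
    - apply Rmin_glb_lt; lra.
    - apply Rmin_l.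
    - apply Rmin_r. }
  exists (x, y + t); split; [apply H; lra |].
  apply B; split.
  - apply (ball_center x eps).
  - change (Rabs (y + t - y) < eps); pose proof (cond_pos eps).
    rewrite Rabs_pos_eq; lra.
Qed.

Lemma continuous_height :
  forall (g : R -> R) (p : R * R),
    continuous g (snd p) -> continuous (fun q => g (snd q)) p.
Proof.
  intros g p C; apply (continuous_comp snd g); [apply continuous_snd | exact C].
Qed.

Lemma closure_ge0 :
  forall (Omega : R * R -> Prop) (g : R -> R),
    (forall y, continuous g y) ->
    (forall p, Omega p <-> 0 < g (snd p)) ->
    forall p, closure Omega p -> 0 <= g (snd p).
Proof.
  intros Omega g Cg Og p C; apply Rnot_lt_le; intros L.
  destruct (C (fun q => g (snd q) < 0)) as (q & Oq & Uq).
  - exact (continuous_height g p (Cg _) (fun z => z < 0) (open_lt 0 _ L)).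
  - apply Og in Oq; lra.
Qed.

Lemma boundary_eq0 :
  forall (Omega : R * R -> Prop) (g : R -> R),
    (forall y, continuous g y) ->
    (forall p, Omega p <-> 0 < g (snd p)) ->
    forall p, boundary Omega p -> g (snd p) = 0.
Proof.
  intros Omega g Cg Og p [C N].
  destruct (closure_ge0 Omega g Cg Og p C) as [L | <-]; [| reflexivity].
  exfalso; apply N.
  apply (filter_imp (fun q => 0 < g (snd q))).
  - intros q; apply Og.
  - exact (continuous_height g p (Cg _) (fun z => 0 < z) (open_gt 0 _ L)).
Qed.

(** * The flow of a profile *)

Lemma arctan_slope_bounds : forall w p, 0 < arctan_slope w p <= 1.
Proof.
  intros w p; unfold arctan_slope; pose proof (denominator_pos w p); split.
  - now apply Rinv_0_lt_compat.
  - rewrite <- Rinv_1; apply Rinv_le_contravar; [lra |].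
    pose proof (pow2_ge_0 (layer w (fst p) * prof w (snd p))); lra.
Qed.

Lemma velocity_bounded :
  forall w (D : R * R -> Prop),
    bounded_on D (fun p => (eval w vel1 p, eval w (vel2 w) p)).
Proof.
  intros w D.
  destruct (prof_bounded w) as [A HA], (slope_bounded w) as [B HB].
  exists (sqrt 2 * Rmax B (rate w * A)); intros p _.
  eapply Rle_trans; [apply norm_prod |].
  apply Rmult_le_compat_l; [apply sqrt_pos |].
  pose proof (one_minus_tanh2_pos (rate w * fst p)) as T.
  change (0 < 1 - layer w (fst p) ^ 2) in T.
  pose proof (arctan_slope_bounds w p) as Dn; pose proof (rate_pos w) as K.
  specialize (HA (snd p)); specialize (HB (snd p)).
  rewrite vel1_eq, vel2_eq.
  set (x := layer w (fst p)) in *; set (d := arctan_slope w p) in *.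
  assert (X : Rabs x <= 1) by (apply Rabs_le; nra).
  assert (X2 : Rabs (1 - x ^ 2) <= 1) by (rewrite Rabs_pos_eq; nra).
  assert (Dd : Rabs d <= 1) by (rewrite Rabs_pos_eq; lra).
  assert (contract : forall a b M, Rabs a <= 1 -> Rabs b <= M ->
            Rabs (a * b) <= M).
  { intros a b M Ha Hb; rewrite Rabs_mult.
    pose proof (Rabs_pos a); pose proof (Rabs_pos b); nra. }
  apply Rmax_lub.
  - eapply Rle_trans; [| apply Rmax_l].
    change (Rabs (- (x * slope w (snd p)) * d) <= B).
    replace (- (x * slope w (snd p)) * d) with (d * (x * - slope w (snd p)))
      by ring.
    apply contract, contract; try easy; now rewrite Rabs_Ropp.
  - eapply Rle_trans; [| apply Rmax_r].
    change (Rabs (rate w * (1 - x ^ 2) * prof w (snd p) * d) <= rate w * A).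
    replace (rate w * (1 - x ^ 2) * prof w (snd p) * d)
      with (d * ((1 - x ^ 2) * (rate w * prof w (snd p)))) by ring.
    apply contract, contract; try easy.
    rewrite Rabs_mult, (Rabs_pos_eq (rate w)) by lra.
    apply Rmult_le_compat_l; lra.
Qed.

Lemma upper_angles_attained :
  forall w (D : R * R -> Prop) yb y0,
    (forall x, D (x, yb)) -> prof w yb = 0 -> slope w yb <> 0 ->
    (forall x, D (x, y0)) -> 0 < prof w y0 -> slope w y0 <> 0 ->
    forall e, upper_semicircle e ->
      flow_angles (fun p => (eval w vel1 p, eval w (vel2 w) p)) D e.
Proof.
  intros w D yb y0 Db Gb Hb D0 G0 H0 [a b] E.
  apply upper_semicircle_iff in E; destruct E as [E B].
  pose proof (rate_pos w) as K.
  destruct B as [B | <-].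
  - (* on the line y = y0 the ratio v1 / v2 takes every real value *)
    destruct (tanh_ratio_surjective
                (- (a * (rate w * prof w y0)) / (b * slope w y0)))
      as [t Ht].
    pose proof (one_minus_tanh2_pos t) as T.
    pose proof (arctan_slope_bounds w (t / rate w, y0)) as Dn.
    assert (L : layer w (t / rate w) = tanh t)
      by (unfold layer; f_equal; field; lra).
    apply (flow_angle_of_positive_multiple _ D (t / rate w, y0)
      (rate w * (1 - tanh t ^ 2) * prof w y0
         * arctan_slope w (t / rate w, y0) / b)); [easy | | exact E |].
    + apply Rdiv_lt_0_compat; [| exact B].
      repeat apply Rmult_lt_0_compat; lra.
    + rewrite vel1_eq, vel2_eq; cbn [fst snd]; rewrite L.
      f_equal; [| field; lra].
      rewrite Ht at 1; field; split; [lra | exact H0].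
  - (* on the line y = yb the flow is horizontal, directed by the sign of x *)
    set (t := - (a * slope w yb)).
    assert (nz : t <> 0).
    { unfold t; apply Ropp_neq_0_compat, Rmult_integral_contrapositive.
      split; [nra | exact Hb]. }
    pose proof (mul_tanh_pos t nz) as T.
    pose proof (arctan_slope_bounds w (t / rate w, yb)) as Dn.
    assert (L : layer w (t / rate w) = tanh t)
      by (unfold layer; f_equal; field; lra).
    apply (flow_angle_of_positive_multiple _ D (t / rate w, yb)
      (t * tanh t * arctan_slope w (t / rate w, yb))); [easy | | exact E |].
    + apply Rmult_lt_0_compat; lra.
    + rewrite vel1_eq, vel2_eq; cbn [fst snd]; rewrite L, Gb.
      f_equal; [| ring].
      transitivity (- (tanh t * slope w yb) * arctan_slope w (t / rate w, yb)
                    * (a ^ 2 + 0 ^ 2)); [rewrite E; ring | unfold t; ring].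
Qed.

(** Writing the domain as the set where a continuous function [g] of the height
    is positive treats the strip and the half-plane alike.  The line [y = yb]
    carries the two horizontal angles, and [y = y0] the others. *)
Lemma profile_flow :
  forall w (Omega : R * R -> Prop) (g : R -> R) yb y0,
    (forall y, continuous g y) ->
    (forall p, Omega p <-> 0 < g (snd p)) ->
    (forall y, 0 <= g y -> 0 <= prof w y) ->
    (forall y, g y = 0 -> prof w y = 0) ->
    (forall t, 0 < t < 1 -> 0 < g (yb + t)) ->
    prof w yb = 0 -> slope w yb <> 0 ->
    0 < g y0 -> 0 < prof w y0 -> slope w y0 <> 0 ->
    exists v : R * R -> R * R,
      let v1 := fun p => fst (v p) in
      let v2 := fun p => snd (v p) in
      smooth_on_closure Omega v1 /\
      smooth_on_closure Omega v2 /\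
      bounded_on (closure Omega) v /\
      (exists P : R * R -> R, steady_euler_slip Omega v1 v2 P) /\
      (same_set (flow_angles v (closure Omega)) upper_semicircle \/
       same_set (flow_angles v (closure Omega)) lower_semicircle).
Proof.
  intros w Omega g yb y0 Cg Og Gge0 Geq0 Above Gb Hb g0 G0 H0.
  exists (fun p => (eval w vel1 p, eval w (vel2 w) p)); intros v1 v2.
  split; [apply (eval_smooth Omega w vel1) |].
  split; [apply (eval_smooth Omega w (vel2 w)) |].
  split; [apply velocity_bounded |].
  split; [| left].
  - exists (eval w (pressure w)); split.
    + intros p _; split; [apply eval_ex_filterdiff | apply euler_equations].
    + intros p Bp; unfold v2; cbn [snd]; rewrite vel2_eq.
      rewrite (Geq0 (snd p)); [ring |].
      now apply (boundary_eq0 Omega g).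
  - intros e; split.
    + intros (p & Cp & N & ->).
      apply flow_angle_upper; [exact N |].
      rewrite vel2_eq.
      pose proof (one_minus_tanh2_pos (rate w * fst p)).
      pose proof (arctan_slope_bounds w p); pose proof (rate_pos w).
      repeat apply Rmult_le_pos; try lra; [unfold layer; lra |].
      now apply Gge0, (closure_ge0 Omega g).
    + apply (upper_angles_attained w (closure Omega) yb y0); try easy.
      * intros x; apply closure_from_above; intros t Ht.
        now apply Og, Above.
      * intros x; now apply closure_incl, Og.
Qed.

(** * The two profiles *)

Lemma half_plane_profile :
  exists w, prof w = tanh /\ slope w = fun y => 1 - tanh y ^ 2.
Proof.
  assert (B : forall y, -1 < tanh y < 1)
    by (intros y; pose proof (one_minus_tanh2_pos y); nra).
  unshelve eexists {| rate := 1; lin := -2; prof := tanh;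
                      slope := fun y => 1 - tanh y ^ 2 |}.
  7: now split.
  - lra.
  - exact is_derive_tanh.
  - intros y; evar_last.
    + apply (is_derive_comp (fun z => 1 - z ^ 2)); [| apply is_derive_tanh].
      auto_derive; [trivial | reflexivity].
    + unfold scal; cbn; unfold mult; cbn; ring.
  - intros y; cbn; ring.
  - exists 1; intros y; apply Rabs_le; specialize (B y); lra.
  - exists 1; intros y; apply Rabs_le; specialize (B y); nra.
Qed.

(** Global solution of [phi' = h phi], [phi 0 = 0], by separation of
    variables: [phi] is the inverse of [Y s], the integral of [1 / h] from [0]
    to [s].  The bound [h <= 1] gives [Y' >= 1], so that [Y] maps onto the
    line and its inverse is 1-Lipschitz. *)
Lemma autonomous_flow :
  forall h : R -> R,
    (forall s, continuous h s) -> (forall s, 0 < h s <= 1) ->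
    exists phi Y : R -> R,
      Y 0 = 0 /\ (forall s t, s < t -> Y s < Y t) /\
      (forall s, phi (Y s) = s) /\ (forall y, Y (phi y) = y) /\
      (forall y, is_derive phi y (h (phi y))).
Proof.
  intros h Ch Bh.
  set (Y := (fun s => RInt (fun r => / h r) 0 s) : R -> R).
  assert (Ci : forall s, continuous (fun r => / h r) s).
  { intros s; apply continuous_Rinv_comp; [apply Ch |].
    specialize (Bh s); lra. }
  assert (DY : forall s, is_derive Y s (/ h s)).
  { intros s; apply (is_derive_RInt (fun r => / h r) Y 0 s); [| apply Ci].
    apply filter_forall; intros b.
    apply (RInt_correct (V := R_CompleteNormedModule)).
    apply (ex_RInt_continuous (V := R_CompleteNormedModule)); intros; apply Ci. }
  assert (Y0 : Y 0 = 0) by apply (RInt_point (V := R_CompleteNormedModule)).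
  assert (stretch : forall s t, s <= t -> t - s <= Y t - Y s).
  { intros s t L.
    destruct (MVT_gen Y s t (fun r => / h r)) as (c & _ & E).
    - intros; apply DY.
    - intros; apply continuity_pt_filterlim.
      now apply (is_derive_continuous Y _ _ (DY _)).
    - rewrite E; specialize (Bh c).
      assert (1 <= / h c) by (rewrite <- Rinv_1; apply Rinv_le_contravar; lra).
      nra. }
  assert (inc : forall s t, s < t -> Y s < Y t)
    by (intros s t L; specialize (stretch s t); lra).
  assert (onto : forall y : R, {s | Y s = y}).
  { intros y.
    assert (L : - Rabs y <= y <= Rabs y) by (apply Rabs_le_between; lra).
    pose proof (Rabs_pos y) as A.
    pose proof (stretch (- Rabs y) 0 ltac:(lra)).
    pose proof (stretch 0 (Rabs y) ltac:(lra)).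
    destruct (IVT_gen Y (- Rabs y) (Rabs y) y) as (s & _ & E).
    - intros s; apply continuity_pt_filterlim.
      now apply (is_derive_continuous Y _ _ (DY _)).
    - rewrite Rmin_left, Rmax_right; lra.
    - now exists s. }
  set (phi := fun y : R => proj1_sig (onto y)).
  assert (Yphi : forall y : R, Y (phi y) = y)
    by (intros y; exact (proj2_sig (onto y))).
  assert (phiY : forall s, phi (Y s) = s).
  { intros s; destruct (Rtotal_order (phi (Y s)) s) as [L | [E | L]];
      [| exact E |]; apply inc in L; rewrite Yphi in L; lra. }
  assert (lip : forall y z : R, Rabs (phi y - phi z) <= Rabs (y - z)).
  { intros y z; rewrite <- (Yphi y), <- (Yphi z) at 2.
    destruct (Rle_dec (phi y) (phi z)) as [L | L].
    - specialize (stretch _ _ L).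
      rewrite !Rabs_left1; lra.
    - specialize (stretch (phi z) (phi y) ltac:(lra)).
      rewrite !Rabs_pos_eq; lra. }
  exists phi, Y; do 4 (split; [assumption |]).
  intros y; apply is_derive_Reals; intros eps eps0.
  specialize (DY (phi y)); apply is_derive_Reals in DY.
  destruct (DY eps eps0) as [del Hdel]; exists del; intros z z0 Hz.
  set (dphi := phi (y + z) - phi y).
  pose proof (lip (y + z) y) as small; fold dphi in small.
  replace (y + z - y) with z in small by ring.
  assert (shift : phi y + dphi = phi (y + z)) by (unfold dphi; ring).
  assert (nz : dphi <> 0).
  { intros E; rewrite E, Rplus_0_r in shift.
    apply (f_equal Y) in shift; rewrite !Yphi in shift; lra. }
  specialize (Hdel dphi nz ltac:(lra)).
  rewrite shift, !Yphi in Hdel.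
  replace (y + z - y) with z in Hdel by ring.
  specialize (Bh (phi y)).
  set (H := h (phi y)) in *.
  (* The difference quotient of Y at phi y, with increment dphi, is z / dphi;
     inverting it costs no precision because h <= 1 and |dphi| <= |z|. *)
  replace (dphi / z - H) with (- (z / dphi - / H) * (H * (dphi / z)))
    by (field; lra).
  rewrite Rabs_mult, Rabs_Ropp.
  assert (q : Rabs (H * (dphi / z)) <= 1).
  { rewrite Rabs_mult, Rabs_div, (Rabs_pos_eq H) by lra.
    pose proof (Rabs_pos_lt z z0).
    assert (Rabs dphi / Rabs z <= 1).
    { apply Rmult_le_reg_r with (Rabs z); [lra |].
      replace (Rabs dphi / Rabs z * Rabs z) with (Rabs dphi) by (field; lra).
      lra. }
    assert (0 <= Rabs dphi / Rabs z)
      by (apply Rmult_le_pos; [apply Rabs_pos |];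
          apply Rlt_le, Rinv_0_lt_compat; lra).
    nra. }
  pose proof (Rabs_pos (z / dphi - / H)).
  pose proof (Rabs_pos (H * (dphi / z))); nra.
Qed.

(** The profile is [m sn] with modulus [m^2], where [m = 1 / 2]: if
    [theta' = lam sqrt (1 - m^4 sin^2 theta)], then [G = m sin theta] satisfies
    [G'^2 = lam^2 (m^2 - G^2) (1 - m^2 G^2)], which is the energy identity with
    [k = m lam] and [q = - lam^2 (1 + m^4)].  Any [m] strictly between [0] and
    [1] would do.  The strip has width [2], so [lam] is half the time that the
    solution with [lam = 1] takes from [0] to [PI]. *)
Lemma strip_profile :
  exists w y0,
    (forall y, -1 <= y <= 1 -> 0 <= prof w y) /\
    prof w (-1) = 0 /\ prof w 1 = 0 /\ slope w (-1) <> 0 /\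
    -1 < y0 < 1 /\ 0 < prof w y0 /\ slope w y0 <> 0.
Proof.
  set (h := fun s => sqrt (1 - sin s ^ 2 / 16)).
  assert (sin2 : forall s, 0 <= sin s ^ 2 <= 1).
  { intros s; pose proof (SIN_bound s); nra. }
  assert (h2 : forall s, h s ^ 2 = 1 - sin s ^ 2 / 16)
    by (intros s; apply pow2_sqrt; specialize (sin2 s); lra).
  assert (Bh : forall s, 0 < h s <= 1).
  { intros s; specialize (sin2 s); specialize (h2 s).
    assert (0 < h s) by (apply sqrt_lt_R0; lra).
    split; [easy | nra]. }
  assert (Dh : forall s, is_derive h s (- (sin s * cos s) / 16 / h s)).
  { intros s; specialize (sin2 s); specialize (Bh s); evar_last.
    - apply (is_derive_sqrt (fun s => 1 - sin s ^ 2 / 16)); [| lra].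
      auto_derive; [trivial | reflexivity].
    - fold (h s); field; lra. }
  destruct (autonomous_flow h) as (phi & Y & Y0 & inc & phiY & Yphi & Dphi);
    [intros s; eapply is_derive_continuous, Dh | exact Bh |].
  pose proof PI_RGT_0 as pi.
  set (lam := Y PI / 2).
  assert (lam0 : 0 < lam)
    by (unfold lam; pose proof (inc 0 PI pi); lra).
  set (th := fun y => phi (lam * (y + 1))).
  assert (Dth : forall y, is_derive th y (lam * h (th y))).
  { intros y; apply (is_derive_comp phi (fun y => lam * (y + 1))).
    - apply Dphi.
    - auto_derive; [trivial | ring]. }
  assert (thY : forall s, th (Y s / lam - 1) = s).
  { intros s; unfold th.
    replace (lam * (Y s / lam - 1 + 1)) with (Y s) by (field; lra).
    apply phiY. }
  assert (th_left : th (-1) = 0)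
    by (rewrite <- (thY 0), Y0; f_equal; field; lra).
  assert (th_right : th 1 = PI)
    by (rewrite <- (thY PI); f_equal; unfold lam in *; field; lra).
  assert (th_inc : forall y z, y <= z -> th y <= th z).
  { intros y z L; apply Rnot_lt_le; intros C; unfold th in C.
    apply inc in C; rewrite !Yphi in C; nra. }
  unshelve eexists {|
    rate := lam / 2; lin := - 17 / 16 * lam ^ 2;
    prof := fun y => sin (th y) / 2;
    slope := fun y => lam / 2 * (cos (th y) * h (th y)) |}.
  - lra.
  - intros y; evar_last.
    + apply (is_derive_comp (fun s => sin s / 2)); [| apply Dth].
      auto_derive; [trivial | reflexivity].
    + unfold scal; cbn; unfold mult; cbn; field.
  - intros y; evar_last.
    + apply (is_derive_comp (fun s => lam / 2 * (cos s * h s)));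
        [| apply Dth].
      apply (is_derive_scal (fun s => cos s * h s)).
      apply (is_derive_mult cos h);
        [apply is_derive_cos | apply Dh | exact Rmult_comm].
    + specialize (h2 (th y)); specialize (Bh (th y)).
      pose proof (sin2_cos2 (th y)) as S; unfold Rsqr in S.
      set (s := sin (th y)) in *; set (c := cos (th y)) in *.
      set (H := h (th y)) in *.
      unfold scal, plus; cbn; unfold mult; cbn.
      transitivity (lam ^ 2 / 2 * (- s * H ^ 2 - s * c ^ 2 / 16));
        [field; lra |].
      rewrite h2.
      replace (c ^ 2) with (1 - s ^ 2) by lra.
      field.
  - intros y; cbn beta.
    pose proof (sin2_cos2 (th y)) as S; unfold Rsqr in S.
    specialize (h2 (th y)).
    set (s := sin (th y)) in *; set (c := cos (th y)) in *.
    set (H := h (th y)) in *.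
    replace ((lam / 2 * (c * H)) ^ 2) with (lam ^ 2 / 4 * c ^ 2 * H ^ 2)
      by field.
    rewrite h2; replace (c ^ 2) with (1 - s ^ 2) by lra.
    field.
  - exists 1; intros y; pose proof (SIN_bound (th y)).
    apply Rabs_le; lra.
  - exists (lam / 2); intros y; pose proof (COS_bound (th y)) as C.
    specialize (Bh (th y)).
    assert (-1 <= cos (th y) * h (th y) <= 1) by (split; nra).
    apply Rabs_le; split; nra.
  (* y0 is the height where theta = PI / 4 *)
  - exists (Y (PI / 4) / lam - 1); cbn [prof slope].
    rewrite thY, th_left, th_right, sin_0, sin_PI, cos_0, sin_PI4, cos_PI4.
    pose proof (Bh 0); pose proof (Bh (PI / 4)).
    assert (r : 0 < 1 / sqrt 2)
      by (apply Rdiv_lt_0_compat; [| apply sqrt_lt_R0]; lra).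
    repeat split; try lra.
    + intros y [L U]; apply th_inc in L, U; rewrite th_left in L.
      rewrite th_right in U.
      pose proof (sin_ge_0 _ L U); lra.
    + nra.
    + pose proof (inc 0 (PI / 4) ltac:(lra)).
      assert (0 < Y (PI / 4) / lam) by (apply Rdiv_lt_0_compat; lra); lra.
    + assert (Y (PI / 4) / lam < 2); [| lra].
      pose proof (inc (PI / 4) PI ltac:(lra)).
      apply Rmult_lt_reg_r with lam; [lra |].
      replace (Y (PI / 4) / lam * lam) with (Y (PI / 4)) by (field; lra).
      unfold lam; lra.
    + apply Rgt_not_eq, Rmult_lt_0_compat; [| apply Rmult_lt_0_compat]; lra.
Qed.

Theorem theorem1p3 :
  forall Omega : R * R -> Prop,
    Omega = strip \/ Omega = upper_half_plane ->
    exists v : R * R -> R * R,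
      let v1 := fun p => fst (v p) in
      let v2 := fun p => snd (v p) in
      smooth_on_closure Omega v1 /\
      smooth_on_closure Omega v2 /\
      bounded_on (closure Omega) v /\
      (exists P : R * R -> R, steady_euler_slip Omega v1 v2 P) /\
      (same_set (flow_angles v (closure Omega)) upper_semicircle \/
       same_set (flow_angles v (closure Omega)) lower_semicircle).
Proof.
  intros Omega [-> | ->].
  - destruct strip_profile
      as (w & y0 & G & Gl & Gr & Hl & B0 & G0 & H0).
    apply (profile_flow w strip (fun y => 1 - y ^ 2) (-1) y0);
      try assumption.
    + intros y; eapply is_derive_continuous; auto_derive;
        [trivial | reflexivity].
    + intros p; unfold strip; split; intros; nra.
    + intros y L; apply G; nra.
    + intros y E.
      assert (F : (y - 1) * (y + 1) = 0) by nra.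
      apply Rmult_integral in F; destruct F as [F | F].
      * now replace y with 1 by lra.
      * now replace y with (-1) by lra.
    + intros t Ht; nra.
    + nra.
  - destruct half_plane_profile as (w & EG & EH).
    assert (t1 : 0 < tanh 1) by (pose proof (mul_tanh_pos 1 ltac:(lra)); lra).
    assert (t0 : tanh 0 = 0)
      by (unfold tanh; rewrite sinh_0; unfold Rdiv; ring).
    apply (profile_flow w upper_half_plane (fun y => y) 0 1);
      rewrite ?EG, ?EH; try lra.
    + intros y; apply continuous_id.
    + reflexivity.
    + intros y [L | <-]; [| lra].
      pose proof (mul_tanh_pos y ltac:(lra)); nra.
    + now intros y ->.
    + intros t Ht; lra.
    + rewrite t0; lra.
    + apply Rgt_not_eq, (one_minus_tanh2_pos 1).
Qed.
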